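(* Let $f\in\mathbb{Q}[x]$ be an irreducible polynomial of degree four with distinct roots $x_1,x_2,x_3,x_4$, let $L=\mathbb{Q}(x_1,x_2,x_3,x_4)$, and let $a,b,c,d$ be integers such that the $24$ values $$V_\sigma = a x_{\sigma(1)}+b x_{\sigma(2)}+c x_{\sigma(3)}+d x_{\sigma(4)}\qquad(\sigma\in S_4)$$ are pairwise distinct. Let $W\subseteq S_4$ be a groupe de permutations whose associated groupe de substitutions $H$ is contained in the Galois group of $L/\mathbb{Q}$ (viewed as a subgroup of $S_4$), and let $M=L^H$ be the intermediate field corresponding to $H$. Then the polynomial $$\prod_{\sigma\in W}(v-V_\sigma)$$ belongs to $M[v]$, and it is the minimal polynomial over $M$ of each of its roots.
   Context: Permutations are composed from right to left. For permutations $p,q\in S_4$, the substitution $\begin{pmatrix}p\\ q\end{pmatrix}$ is the map sending $p(s)$ to $q(s)$ for each $s$, i.e. the permutation $qp^{-1}$. A nonempty set $W=\{p_1,\dots,p_k\}$ of permutations is a groupe de permutations if for every $1\le i\le k$ the set of substitutions $\left\{\begin{pmatrix}p_1\\ p_j\end{pmatrix}:1\le j\le k\right\}$ equals the set of substitutions $\left\{\begin{pmatrix}p_i\\ p_j\end{pmatrix}:1\le j\le k\right\}$. This common set $\{p_jp_1^{-1}:1\le j\le k\}$ is the associated groupe de substitutions $H$; it is a subgroup of $S_4$. The Galois group of $L/\mathbb{Q}$ is viewed as a subgroup of $S_4$ by identifying an automorphism $\tau$ with the permutation $\sigma$ satisfying $\tau(x_s)=x_{\sigma(s)}$ for $s=1,2,3,4$.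 $L^H$ denotes the fixed field of $H$. *)

(* Defs.v *)
From HB Require Import structures.
From mathcomp Require Import all_boot all_order all_algebra all_fingroup all_field.

Set Implicit Arguments.
Unset Strict Implicit.
Unset Printing Implicit Defensive.

Import GRing.Theory.
Local Open Scope ring_scope.

(* The map p(s) |-> q(s), i.e. q p^-1 for composition from right to left: in
   MathComp, (u * v) s = v (u s). *)
Definition substitution (n : nat) (p q : 'S_n) : 'S_n := (p^-1 * q)%g.

Definition substitutions_from (n : nat) (W : {set 'S_n}) (p : 'S_n) :
  {set 'S_n} := [set substitution p q | q in W].

Definition groupe_de_permutations (n : nat) (W : {set 'S_n}) : Prop :=
  W != set0 /\
  {in W &, forall p q, substitutions_from W p = substitutions_from W q}.

(* [repr W] is an element of W when W is nonempty; for a groupe de permutations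
   the result does not depend on which element is chosen. *)
Definition groupe_de_substitutions (n : nat) (W : {set 'S_n}) : {set 'S_n} :=
  substitutions_from W (repr W).

Definition gal_acts_as (n : nat) (F : fieldType) (L : splittingFieldType F)
    (x : 'I_n -> L) (tau : gal_of {:L}) (s : 'S_n) : bool :=
  [forall i, tau (x i) == x (s i)].

Definition galois_perms (n : nat) (F : fieldType) (L : splittingFieldType F)
    (x : 'I_n -> L) : {set 'S_n} :=
  [set s : 'S_n | [exists tau in 'Gal({:L} / 1)%g, gal_acts_as x tau s]].

Definition perms_fixedField (n : nat) (F : fieldType)
    (L : splittingFieldType F) (x : 'I_n -> L) (H : {set 'S_n}) :
    {subfield L} :=
  fixedField_aspace
    [set tau in 'Gal({:L} / 1)%g | [exists s in H, gal_acts_as x tau s]].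

Definition galois_V (L : nzRingType) (x : 'I_4 -> L) (a b c d : int)
    (s : 'S_4) : L :=
  x (s 0) *~ a + x (s 1) *~ b + x (s 2) *~ c + x (s 3) *~ d.

(* Main.v *)
(* For h in H, an automorphism acting on the roots as h sends V_s to V_(s * h).
   The defining property of W says that W = s H for every s in W; hence these
   automorphisms permute the factors of P, which puts its coefficients in M,
   and they act transitively on its roots, so that every root of P is a root
   of the minimal polynomial over M of any other. *)
Require Import Defs.
From HB Require Import structures.
From mathcomp Require Import all_boot all_order all_algebra all_fingroup all_field.

Set Implicit Arguments.
Unset Strict Implicit.
Unset Printing Implicit Defensive.

Import GRing.Theory.
Local Open Scope ring_scope.

(** The set of substitutions may be based at [s] instead of [repr W], which makes it the translate
    of [W] by [s^-1]. *)
Lemma mem_mul_groupe (n : nat) (W : {set 'S_n}) (s h : 'S_n) :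
  groupe_de_permutations W -> s \in W ->
  ((s * h)%g \in W) = (h \in groupe_de_substitutions W).
Proof.
move=> [W_n0 W_eq] sW.
rewrite /groupe_de_substitutions (W_eq _ s) //; last first.
  by case/set0Pn: W_n0 => t; apply: mem_repr.
apply/idP/imsetP => [shW | [t tW ->]]; last by rewrite mulKVg.
by exists (s * h)%g; rewrite // /substitution mulKg.
Qed.

(** Right translation by [h] is injective and maps the finite set [W] into itself, hence onto
    itself; this gives the converse implication without inverting [h] inside the groupe de
    substitutions. *)
Lemma groupe_mulr (n : nat) (W : {set 'S_n}) (s h : 'S_n) :
  groupe_de_permutations W -> h \in groupe_de_substitutions W ->
  ((s * h)%g \in W) = (s \in W).
Proof.
move=> W_groupe hH.
have {1}<- : [set (t * h)%g | t in W] = W.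
  apply/eqP; rewrite eqEcard card_imset ?leqnn ?andbT; last exact: mulIg.
  by apply/subsetP => _ /imsetP[t tW ->]; rewrite mem_mul_groupe.
by apply: (mem_imset _ _ (mulIg h)).
Qed.

Lemma gal_galois_V (F : fieldType) (L : splittingFieldType F) (x : 'I_4 -> L)
    (a b c d : int) (tau : gal_of {:L}) (s h : 'S_4) :
  gal_acts_as x tau h ->
  tau (galois_V x a b c d s) = galois_V x a b c d (s * h)%g.
Proof.
move=> /forallP tau_h; have tauE i : tau (x i) = x (h i) by apply/eqP.
by rewrite /galois_V !rmorphD /= !rmorphMz /= !tauE !permM.
Qed.

(** The coefficients are fixed by [tau], so the polynomial equals its own image under [tau], which
    vanishes at [tau y]. *)
Lemma root_minPoly_fixedField (F : fieldType) (L : splittingFieldType F)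
    (A : {set gal_of {:L}}) (tau : gal_of {:L}) (y : L) :
  tau \in A -> root (minPoly (fixedField A) y) (tau y).
Proof.
move=> tauA.
have -> : minPoly (fixedField A) y = map_poly tau (minPoly (fixedField A) y).
  apply/polyP => i; rewrite coef_map /=.
  have /fixedFieldP-> // := polyOverP (minPolyOver (fixedField A) y) i.
  exact: memvf.
by rewrite fmorph_root root_minPoly.
Qed.

Theorem proposition1 (L : splittingFieldType rat) (f : {poly rat})
    (x : 'I_4 -> L) (a b c d : int) (W : {set 'S_4})
    (f_irr : irreducible_poly f)
    (f_deg : size f = 5%N)
    (x_inj : injective x)
    (x_root : forall i, root (map_poly (in_alg L) f) (x i))
    (x_gen : <<1 & codom x>>%VS = {:L}%VS)
    (V_inj : injective (galois_V x a b c d))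
    (W_groupe : groupe_de_permutations W)
    (H_gal : groupe_de_substitutions W \subset galois_perms x) :
  let M := perms_fixedField x (groupe_de_substitutions W) in
  let P := \prod_(s in W) ('X - (galois_V x a b c d s)%:P) in
  P \is a polyOver M /\ (forall y : L, root P y -> minPoly M y = P).
Proof.
move=> M P.
have P_over : P \is a polyOver M.
  apply/polyOverP => i; apply/fixedFieldP; first exact: memvf.
  move=> tau; rewrite inE => /andP[_ /exists_inP[h hH tau_h]].
  rewrite -[LHS]coef_map; congr (polyseq _)`_i.
  (* Translation by [h] permutes [W], so after this reindexing the factors agree one by one. *)
  rewrite rmorph_prod /= [RHS](reindex_inj (mulIg h)) /=.
  apply: eq_big => [s | s sW]; first by rewrite groupe_mulr.
  by rewrite rmorphB /= map_polyX map_polyC /= (gal_galois_V _ _ _ _ _ tau_h).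
split=> // y Py.
have [s sW yE] : exists2 s, s \in W & y = galois_V x a b c d s.
  move: Py; rewrite /P -big_enum /= -(big_map _ xpredT (fun z => 'X - z%:P)).
  rewrite root_prod_XsubC => /mapP[s sW ->].
  by exists s; rewrite // -mem_enum.
(* Two monic polynomials that divide each other are equal. As [P] lies over [M] and vanishes at [y],
   only [P] dividing the minimal polynomial is left. *)
apply/eqP; rewrite -eqp_monic ?monic_minPoly ?monic_prod_XsubC //.
rewrite /eqp minPoly_dvdp //=.
rewrite /P -big_enum /= -(big_map _ xpredT (fun z => 'X - z%:P)).
(* By [V_inj] the linear factors are distinct, so it suffices that each [V_t] with [t] in [W] is a
   root. *)
apply: uniq_roots_dvdp; last first.
  by rewrite uniq_rootsE map_inj_uniq ?enum_uniq.
apply/allP => _ /mapP[t tW ->]; rewrite mem_enum in tW.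
(* The automorphism that acts as the substitution from [s] to [t] carries [y] to [V_t]. *)
have hH : (s^-1 * t)%g \in groupe_de_substitutions W.
  by rewrite -(mem_mul_groupe _ W_groupe sW) mulKVg.
have := subsetP H_gal _ hH; rewrite inE => /exists_inP[tau tauG tau_h].
rewrite -[t](mulKVg s) -(gal_galois_V _ _ _ _ _ tau_h) -yE.
apply: root_minPoly_fixedField; rewrite inE tauG /=.
by apply/exists_inP; exists (s^-1 * t)%g.
Qed.
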